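(* Let $G$ be an antiferromagnetic weighted graph on vertex set $[n]$ and let $t\ge2$. Then for all $\mathbf{a},\mathbf{b}\in(\mathbb{R}_{\ge0})^n$, \[ V_{K_t}(\mathbf{a},\dots,\mathbf{a};G)\cdot V_{K_t}(\mathbf{b},\dots,\mathbf{b};G)\le \sum_{\phi:[t]\times\{1,2\}\to[n]}\ \prod_{\substack{i,j\in[t]\\ i\ne j}}G(\phi(i,1),\phi(j,2))\prod_{i\in[t]}a_{\phi(i,1)}\,b_{\phi(i,2)}, \] where the right-hand side is the $G$-volume $V_{K_t\times K_2}(\mathbf{a},\dots,\mathbf{a},\mathbf{b},\dots,\mathbf{b};G)$ with $\mathbf{a}$ assigned to the vertices $(i,1)$ and $\mathbf{b}$ to the vertices $(i,2)$ of $K_t\times K_2$.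
   Context: A weighted graph $G$ on $[n]$ is a symmetric matrix with nonnegative entries $G(i,j)$ (loops allowed); it is antiferromagnetic if it has at most one positive eigenvalue, counted with multiplicity. For $\mathbf{x}\in\mathbb{R}^n$, $V_{K_t}(\mathbf{x},\dots,\mathbf{x};G)=\sum_{\phi:[t]\to[n]}\prod_{\{i,j\}\in\binom{[t]}{2}}G(\phi(i),\phi(j))\prod_{s\in[t]}x_{\phi(s)}$. The tensor product $K_t\times K_2$ has vertex set $[t]\times\{1,2\}$ with $(i,1)$ adjacent to $(j,2)$ iff $i\neq j$. *)

(* Defs.v *)
From mathcomp Require Import all_boot all_order all_algebra.
From mathcomp Require Import reals.
Set Implicit Arguments. Unset Strict Implicit. Unset Printing Implicit Defensive.
Import Order.TTheory GRing.Theory Num.Theory.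
Local Open Scope ring_scope.

Definition weighted_graph (R : realType) (n : nat) (G : 'M[R]_n) : Prop :=
  (forall i j, G i j = G j i) /\ (forall i j, 0 <= G i j).

(* At most one positive eigenvalue counted with multiplicity:
   for any finite list of distinct positive reals, the sum of their
   multiplicities as roots of the characteristic polynomial is <= 1. *)
Definition antiferromagnetic (R : realType) (n : nat) (G : 'M[R]_n) : Prop :=
  weighted_graph G /\
  forall s : seq R, uniq s -> all (fun x => 0 < x) s ->
    (\sum_(x <- s) mup x (char_poly G) <= 1)%N.

Definition VKt (R : realType) (n t : nat) (G : 'M[R]_n) (x : 'I_n -> R) : R :=
  \sum_(phi : {ffun 'I_t -> 'I_n})
    (\prod_(i : 'I_t) \prod_(j : 'I_t | (i < j)%N) G (phi i) (phi j)) *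
    \prod_(s : 'I_t) x (phi s).

Definition VKtK2 (R : realType) (n t : nat) (G : 'M[R]_n) (a b : 'I_n -> R) : R :=
  \sum_(phi : {ffun 'I_t * 'I_2 -> 'I_n})
    (\prod_(i : 'I_t) \prod_(j : 'I_t | i != j) G (phi (i, ord0)) (phi (j, ord_max))) *
    \prod_(i : 'I_t) (a (phi (i, ord0)) * b (phi (i, ord_max))).

(* Main.v *)
Require Import Defs.
From mathcomp Require Import all_boot all_order all_algebra.
From mathcomp Require Import reals complex.
From mathcomp Require Import ring lra.
Import Order.TTheory GRing.Theory Num.Theory.
Local Open Scope ring_scope.

(* Induct on [t]. Write [g_u] for the u-th row of [G], and
   [V_t (w_1, ..., w_t)] for the mixed volume of [K_t]. Conditioning on one
   vertex of each copy of [K_t] and using the induction hypothesis, the double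
   cover volume is at least
     \sum_(u, v) a_u b_v V_(t-1) (a g_v) V_(t-1) (b g_u)
       = V_t (b, a, ..., a) V_t (a, b, ..., b),
   so it is enough that this is at least [V_t (a, ..., a) V_t (b, ..., b)].
   That follows from the Alexandrov-Fenchel inequality for [V_t], proved by the
   Bochner method of Shenfeld and van Handel: conditioning on one vertex gives,
   for the matrix [A] of [V_t (., ., c, ...)] and the diagonal matrix
   [D = diag (Ac / c)], the inequality [A <= A D^-1 A], so that the eigenvalues
   of [D^-1 A] are nonpositive or at least 1, and by Perron only the eigenvector
   [c] has a positive one. This needs positive weights; in general, replace [G]
   by [(I + e J) G (I + e J)], [a] by [a + e], [b] by [b + e], and note that the
   inequality is polynomial in [e]. *)

(** * Symmetric matrices with at most one positive eigenvalue *)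

Lemma Re_sum (R : rcfType) (I : finType) (F : I -> R[i]) :
  complex.Re (\sum_i F i) = \sum_i complex.Re (F i).
Proof. by apply: big_morph => // -[? ?] [? ?]. Qed.

Lemma Im_sum (R : rcfType) (I : finType) (F : I -> R[i]) :
  complex.Im (\sum_i F i) = \sum_i complex.Im (F i).
Proof. by apply: big_morph => // -[? ?] [? ?]. Qed.

(* The spectral theorem over [R[i]] split into real and imaginary parts: the
   i-th eigenvector is [p i + 'i * q i]. *)
Lemma sym_spectral (R : rcfType) (n : nat) (A : 'M[R]_n) :
  (forall i j, A i j = A j i) ->
  exists d : 'I_n -> R, exists p q : 'I_n -> 'I_n -> R,
  [/\ forall u v, A u v = \sum_i d i * (p i u * p i v + q i u * q i v),
      forall u v, \sum_i d i * (p i u * q i v - q i u * p i v) = 0,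
      forall i j, \sum_u (p i u * p j u + q i u * q j u) = (i == j)%:R
               /\ \sum_u (q i u * p j u - p i u * q j u) = 0,
      forall i u, \sum_v A u v * p i v = d i * p i u
               /\ \sum_v A u v * q i v = d i * q i u
    & char_poly A = \prod_i ('X - (d i)%:P)].
Proof.
move=> symA.
pose B := map_mx (real_complex R) A.
have hB : B \is hermsymmx.
  apply: realsym_hermsym.
    by apply/is_hermitianmxP; apply/matrixP => i j; rewrite !mxE mul1r symA.
  by apply/mxOverP => i j; rewrite mxE complex_real.
have Bsp := orthomx_spectralP (hermitian_normalmx hB).
have dr := hermitian_spectral_diag_real hB.
have Pu := spectral_unitarymx B.
set P := spectralmx B in Bsp Pu.
set D := spectral_diag B in Bsp dr.
have Puni := spectral_unit B; rewrite -/P in Puni.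
pose d i := complex.Re (D 0 i).
have DE i : D 0 i = real_complex R (d i).
  by rewrite /d RRe_real //; exact: (mxOverP dr).
have PB : P *m B = diag_mx D *m P by rewrite {1}Bsp !mulmxA mulmxV // mul1mx.
have chB : char_poly B = \prod_i ('X - (D 0 i)%:P).
  have -> : char_poly B = char_poly (diag_mx D).
    rewrite /char_poly /char_poly_mx {1}Bsp !map_mxM.
    have e : map_mx polyC (invmx P) *m map_mx polyC P = 1%:M.
      by rewrite -map_mxM mulVmx // map_mx1.
    have eX : 'X%:M = map_mx polyC (invmx P) *m 'X%:M *m map_mx polyC P.
      by rewrite -mulmxA -scalar_mxC mulmxA e mul1mx.
    by rewrite [in LHS]eX -mulmxBl -mulmxBr !det_mulmx mulrAC -det_mulmx e det1 mul1r.
  rewrite char_poly_trig ?diag_mx_is_trig //.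
  by apply: eq_bigr => i _; rewrite mxE eqxx.
exists d, (fun i u => complex.Re (P i u)), (fun i u => complex.Im (P i u)).
have BE u v : real_complex R (A u v) = \sum_i (P i u)^* * D 0 i * P i v.
  transitivity (B u v); first by rewrite mxE.
  rewrite {1}Bsp invmx_unitary // mxE; apply: eq_bigr => i _.
  by rewrite mul_mx_diag !mxE.
split.
- move=> u v; have /(congr1 (@complex.Re R)) := BE u v; rewrite Re_sum /= => ->.
  apply: eq_bigr => i _; rewrite DE.
  case: (P i u) => a b; case: (P i v) => a' b' /=; ring.
- move=> u v; have /(congr1 (@complex.Im R)) := BE u v; rewrite Im_sum /= => e.
  apply: (etrans _ (esym e)); apply: eq_bigr => i _; rewrite DE.
  case: (P i u) => a b; case: (P i v) => a' b' /=; ring.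
- move=> i j; have /unitarymxP/matrixP/(_ i j) := Pu; rewrite !mxE => e.
  split.
    have /(congr1 (@complex.Re R)) := e; rewrite Re_sum.
    have -> : complex.Re ((i == j)%:R : R[i]) = (i == j)%:R by case: eqP.
    move=> <-; apply: eq_bigr => u _; rewrite !mxE.
    case: (P i u) => a b; case: (P j u) => a' b' /=; ring.
  have /(congr1 (@complex.Im R)) := e; rewrite Im_sum.
  have -> : complex.Im ((i == j)%:R : R[i]) = 0 by case: eqP.
  move=> e0; apply: etrans e0; apply: eq_bigr => u _; rewrite !mxE.
  case: (P i u) => a b; case: (P j u) => a' b' /=; ring.
- move=> i u; have /matrixP/(_ i u) := PB.
  rewrite mul_diag_mx !mxE DE => e; split.
    have /(congr1 (@complex.Re R)) := e; rewrite Re_sum.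
    have -> x y : complex.Re (real_complex R x * y) = x * complex.Re y.
      by case: y => a b /=; ring.
    move=> <-; apply: eq_bigr => v _; rewrite !mxE symA.
    case: (P i v) => a b /=; ring.
  have /(congr1 (@complex.Im R)) := e; rewrite Im_sum.
  have -> x y : complex.Im (real_complex R x * y) = x * complex.Im y.
    by case: y => a b /=; ring.
  move=> <-; apply: eq_bigr => v _; rewrite !mxE symA.
  case: (P i v) => a b /=; ring.
- apply: (map_poly_inj (real_complex R)).
  rewrite map_char_poly chB rmorph_prod; apply: eq_bigr => i _.
  by rewrite rmorphB /= map_polyX map_polyC DE.
Qed.

Definition bilin {R : comPzRingType} {n : nat} (A : 'I_n -> 'I_n -> R)
  (x y : 'I_n -> R) : R := \sum_u \sum_v x u * A u v * y v.

(** For a real symmetric [A] this amounts to having at most one positive eigenvalue; it mentions no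
    spectrum, so it passes easily through substitutions of the arguments. *)
Definition reverse_CS {R : numDomainType} {n : nat} (A : 'I_n -> 'I_n -> R) :=
  forall x y, 0 < bilin A y y -> bilin A x x * bilin A y y <= bilin A x y ^+ 2.

(** Meant for congruences: diagonal rescalings of [A], and the perturbation by [I + e J]. *)
Lemma reverse_CS_congr (R : numDomainType) (n m : nat) (A : 'I_n -> 'I_n -> R)
    (B : 'I_m -> 'I_m -> R) (L : ('I_m -> R) -> 'I_n -> R) :
  (forall x y, bilin B x y = bilin A (L x) (L y)) -> reverse_CS A -> reverse_CS B.
Proof. by move=> e hA x y; rewrite !e; apply: hA. Qed.

Lemma bilin_sum (R : comPzRingType) (n : nat) (I : finType) (d : I -> R)
    (p q : I -> 'I_n -> R) (x y : 'I_n -> R) :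
  bilin (fun u v => \sum_i d i * (p i u * q i v)) x y =
  \sum_i d i * ((\sum_u p i u * x u) * (\sum_v q i v * y v)).
Proof.
rewrite /bilin.
under [RHS]eq_bigr do rewrite big_distrlr mulr_sumr.
rewrite [RHS]exchange_big /=; apply: eq_bigr => u _.
under [RHS]eq_bigr do rewrite mulr_sumr.
rewrite [RHS]exchange_big /=; apply: eq_bigr => v _.
by rewrite mulr_sumr mulr_suml; apply: eq_bigr => i _; ring.
Qed.

Lemma bilin_ext (R : comPzRingType) (n : nat) (A B : 'I_n -> 'I_n -> R) x y :
  (forall u v, A u v = B u v) -> bilin A x y = bilin B x y.
Proof.
by move=> e; apply: eq_bigr => u _; apply: eq_bigr => v _; rewrite e.
Qed.

Lemma bilinD (R : comPzRingType) (n : nat) (A B : 'I_n -> 'I_n -> R) x y :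
  bilin (fun u v => A u v + B u v) x y = bilin A x y + bilin B x y.
Proof.
rewrite -big_split; apply: eq_bigr => u _; rewrite -big_split.
by apply: eq_bigr => v _; rewrite /=; ring.
Qed.

Lemma bilinN (R : comPzRingType) (n : nat) (A : 'I_n -> 'I_n -> R) x y :
  bilin (fun u v => - A u v) x y = - bilin A x y.
Proof.
rewrite -sumrN; apply: eq_bigr => u _; rewrite -sumrN.
by apply: eq_bigr => v _; ring.
Qed.

(* If [i] is the only index with [d i > 0], the complex vector
   [z = x - (l x / l y) y], with [l] the i-th coordinate form [p i + 'i q i],
   has no i-th coordinate, so [z^* A z <= 0]; [r] and [t] are the real and
   imaginary parts of [l x / l y]. *)
Lemma spectral_reverse_CS (R : realFieldType) (n : nat) (A : 'I_n -> 'I_n -> R)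
    (d : 'I_n -> R) (p q : 'I_n -> 'I_n -> R) :
  (forall u v, A u v = \sum_i d i * (p i u * p i v + q i u * q i v)) ->
  (forall u v, \sum_i d i * (p i u * q i v - q i u * p i v) = 0) ->
  (forall i j, 0 < d i -> 0 < d j -> i = j) ->
  reverse_CS A.
Proof.
move=> AE A0 d1 x y.
pose P i z := \sum_u p i u * z u.
pose Q i z := \sum_u q i u * z u.
have FE z w : bilin A z w = \sum_i d i * (P i z * P i w + Q i z * Q i w).
  rewrite (@bilin_ext _ _ _ (fun u v => (\sum_i d i * (p i u * p i v)) +
     \sum_i d i * (q i u * q i v))); last first.
    move=> u v; rewrite AE -big_split /=; apply: eq_bigr => i _; ring.
  by rewrite bilinD !bilin_sum -big_split /=; apply: eq_bigr => i _; rewrite mulrDr.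
have F0 : \sum_i d i * (P i x * Q i y - Q i x * P i y) = 0.
  have : bilin (fun _ _ => 0) x y = 0.
    by rewrite /bilin big1 // => u _; rewrite big1 // => v _; ring.
  rewrite (@bilin_ext _ _ _ (fun u v => (\sum_i d i * (p i u * q i v)) +
     - \sum_i d i * (q i u * p i v))); last first.
    move=> u v; apply: etrans (esym (A0 u v)) _.
    by rewrite -sumrN -big_split /=; apply: eq_bigr => i _; ring.
  rewrite bilinD bilinN !bilin_sum -sumrN -big_split /= => e0.
  by apply: etrans e0; apply: eq_bigr => i _; rewrite mulrBr.
case: (pickP (fun i => 0 < d i)) => [k dk|dN]; last first.
  rewrite ltNge FE sumr_le0 // => i _; move: (dN i) => /negbT.
  by rewrite -leNgt => di; apply: mulr_le0_ge0; nra.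
have dle i : i != k -> d i <= 0.
  by move=> ik; rewrite leNgt; apply: contra ik => di; apply/eqP/d1.
(* If the [k]-th coordinate form vanishes at [y], only nonpositive terms are left in [bilin A y y],
   against its positivity. *)
have [s0|sn0] := eqVneq (P k y ^+ 2 + Q k y ^+ 2) 0.
  rewrite ltNge FE sumr_le0 // => i _; have [->|/dle di] := eqVneq i k.
    by rewrite -!expr2 s0 mulr0.
  by apply: mulr_le0_ge0 => //; nra.
move=> Fy.
set s := P k y ^+ 2 + Q k y ^+ 2 in sn0.
pose r := (P k x * P k y + Q k x * Q k y) / s.
pose t := (Q k x * P k y - P k x * Q k y) / s.
have : \sum_i d i * ((P i x - r * P i y + t * Q i y) ^+ 2
                   + (Q i x - r * Q i y - t * P i y) ^+ 2) <= 0.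
  apply: sumr_le0 => i _; have [->|/dle di] := eqVneq i k.
    have -> : P k x - r * P k y + t * Q k y = 0.
      by rewrite /r /t /s; field.
    have -> : Q k x - r * Q k y - t * P k y = 0.
      by rewrite /r /t /s; field.
    by rewrite expr0n /= addr0 mulr0.
  by apply: mulr_le0_ge0 => //; rewrite addr_ge0 ?sqr_ge0.
(* Expansion of [z^* A z]; its only antisymmetric term is the one that [F0] kills. *)
have -> : \sum_i d i * ((P i x - r * P i y + t * Q i y) ^+ 2
                   + (Q i x - r * Q i y - t * P i y) ^+ 2) =
   bilin A x x - 2 * r * bilin A x y + (r ^+ 2 + t ^+ 2) * bilin A y y
   + 2 * t * \sum_i d i * (P i x * Q i y - Q i x * P i y).
  rewrite !FE !mulr_sumr -sumrN -!big_split /=; apply: eq_bigr => i _; ring.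
rewrite F0 mulr0 addr0 => le0.
(* With [a], [b], [c] the values at [(x, x)], [(x, y)], [(y, y)], multiplying by [c] turns the bound
   into [a c - b^2 + (b - r c)^2 + (t c)^2 <= 0]. *)
have := mulr_ge0_le0 (ltW Fy) le0.
have := sqr_ge0 (bilin A x y - r * bilin A y y).
have := sqr_ge0 (t * bilin A y y).
by move: (bilin A x x) (bilin A x y) (bilin A y y) => a b c; nra.
Qed.

(** Two indices with positive [d] would give either one positive root of multiplicity at least 2 or
    two distinct positive roots of the characteristic polynomial; the lists [[:: d i]] and
    [[:: d i; d j]] rule these out. *)
Lemma antiferromagnetic_reverse_CS (R : realType) (n : nat) (G : 'M[R]_n) :
  antiferromagnetic G -> reverse_CS G.
Proof.
case=> -[symG _] mupG.
have [d [p [q [GE G0 _ _ chG]]]] := @sym_spectral R n G symG.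
apply: (@spectral_reverse_CS R n G d p q GE G0) => i j di dj; apply/eqP/negP => /negP ij.
have chE : char_poly G = ('X - (d i)%:P) * ('X - (d j)%:P) *
    \prod_(k | (k != i) && (k != j)) ('X - (d k)%:P).
  by rewrite chG (bigD1 i) //= (bigD1 j) 1?eq_sym //= mulrA.
have ch0 : char_poly G != 0 by rewrite monic_neq0 // char_poly_monic.
have [eij|nij] := eqVneq (d i) (d j).
  have := mupG [:: d i] isT; rewrite /= di big_seq1 leqNgt => /(_ isT).
  by rewrite mup_geq // chE -eij -expr2 dvdp_mulr.
have := mupG [:: d i; d j]; rewrite /= inE nij di dj => /(_ isT isT).
rewrite !big_cons big_nil addn0 leqNgt => /negP; apply.
have hi : (0 < mup (d i) (char_poly G))%N.
  by rewrite -XsubC_dvd // chE -mulrA dvdp_mulr.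
have hj : (0 < mup (d j) (char_poly G))%N.
  by rewrite -XsubC_dvd // chE dvdp_mulr // dvdp_mull.
exact: (leq_add hi hj).
Qed.

Lemma bilinE (R : comPzRingType) (n : nat) (A : 'I_n -> 'I_n -> R) x y :
  bilin A x y = \sum_u x u * \sum_v A u v * y v.
Proof.
apply: eq_bigr => u _; rewrite mulr_sumr; apply: eq_bigr => v _.
by rewrite mulrA.
Qed.

(* Perron: [w/c - A] is the Laplacian bilin
   [1/2 \sum_(u, v) A u v (y u c v - y v c u)^2 / (c u c v)], and the
   hypothesis on [y] forces every positive eigenvalue [d] to be at least 1. *)
Lemma Perron_eigenvector (R : realFieldType) (n : nat) (A : 'I_n -> 'I_n -> R)
    (c w : 'I_n -> R) (d : R) (y : 'I_n -> R) :
  (forall u v, A u v = A v u) -> (forall u v, 0 < A u v) ->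
  (forall u, 0 < c u) ->
  (forall u, \sum_v A u v * c v = w u) ->
  0 < d -> (forall u, \sum_v A u v * y v = d * (w u / c u) * y u) ->
  bilin A y y <= \sum_u c u * (\sum_v A u v * y v) ^+ 2 / w u ->
  forall u v, y u * c v = y v * c u.
Proof.
move=> symA A_gt0 c_gt0 cE d_gt0 yE yle u0 v0.
have w_gt0 u : 0 < w u.
  rewrite -cE (bigD1 u) //= ltr_wpDr ?mulr_gt0 //.
  by apply: sumr_ge0 => v _; rewrite ltW ?mulr_gt0.
pose N := \sum_u w u / c u * y u ^+ 2.
have FE : bilin A y y = d * N.
  rewrite bilinE mulr_sumr; apply: eq_bigr => u _; rewrite yE; ring.
have N_ge0 : 0 <= N.
  by apply: sumr_ge0 => u _; rewrite mulr_ge0 ?sqr_ge0 // ltW ?divr_gt0.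
(* For this [y] the hypothesis reads [d N <= d^2 N]. *)
have Nd : N <= d * N.
  rewrite -(ler_pM2l d_gt0) -{1}FE (le_trans yle) // /N !mulr_sumr ler_sum // => u _.
  rewrite yE le_eqVlt; apply/orP; left; apply/eqP; field.
  by rewrite !lt0r_neq0.
pose T u v := A u v * ((y u * c v - y v * c u) ^+ 2 / (c u * c v)).
have T_ge0 u v : 0 <= T u v.
  by rewrite mulr_ge0 ?divr_ge0 ?sqr_ge0 // ltW ?mulr_gt0.
have sumT : \sum_u \sum_v T u v = 2 * N - 2 * (d * N).
  have -> : \sum_u \sum_v T u v =
      \sum_u \sum_v A u v * c v * (y u ^+ 2 / c u) +
      \sum_u \sum_v A u v * c u * (y v ^+ 2 / c v) - 2 * bilin A y y.
    rewrite mulr_sumr -sumrN -!big_split /=; apply: eq_bigr => u _.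
    rewrite mulr_sumr -sumrN -!big_split /=; apply: eq_bigr => v _.
    by rewrite /T; field; rewrite !lt0r_neq0.
  rewrite [X in _ + X - _]exchange_big /= FE.
  have e u : \sum_v A u v * c v * (y u ^+ 2 / c u) = w u / c u * y u ^+ 2.
    rewrite -mulr_suml cE; ring.
  under eq_bigr do rewrite e.
  under [X in _ + X - _]eq_bigr => u _.
    under eq_bigr do rewrite symA.
    rewrite e; over.
  by rewrite -/N; ring.
have T0 : T u0 v0 <= 0.
  apply: (@le_trans _ _ (\sum_u \sum_v T u v)); last by rewrite sumT; lra.
  rewrite (bigD1 u0) //= (bigD1 v0) //= -addrA lerDl.
  by rewrite addr_ge0 ?sumr_ge0 // => u _; rewrite sumr_ge0.
have /eqP : T u0 v0 = 0 by apply/eqP; rewrite eq_le T0 T_ge0.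
rewrite /T mulf_eq0 (gt_eqF (A_gt0 _ _)) /= mulf_eq0 invr_eq0.
by rewrite (gt_eqF (mulr_gt0 (c_gt0 u0) (c_gt0 v0))) orbF sqrf_eq0 subr_eq0 => /eqP.
Qed.

(** With [D = diag (w / c)], the matrix [D^-1 A] is similar to the symmetric [B = D^-1/2 A D^-1/2],
    which is also congruent to [A]. By the Perron lemma, the eigenvectors of [B] for positive
    eigenvalues all lie on one line, so orthonormality allows only one of them. *)
Lemma reverse_CS_trickle_down (R : rcfType) (n : nat) (A : 'I_n -> 'I_n -> R)
    (c w : 'I_n -> R) :
  (forall u v, A u v = A v u) -> (forall u v, 0 < A u v) ->
  (forall u, 0 < c u) ->
  (forall u, \sum_v A u v * c v = w u) ->
  (forall y, bilin A y y <= \sum_u c u * (\sum_v A u v * y v) ^+ 2 / w u) ->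
  reverse_CS A.
Proof.
move=> symA A_gt0 c_gt0 cE yle.
have w_gt0 u : 0 < w u.
  rewrite -cE (bigD1 u) //= ltr_wpDr ?mulr_gt0 //.
  by apply: sumr_ge0 => v _; rewrite ltW ?mulr_gt0.
(* The diagonal of [D^-1/2]; [B g = d g] becomes [A y = d D y] for [y = s g]. *)
pose s u := Num.sqrt (c u / w u).
have s_gt0 u : 0 < s u by rewrite sqrtr_gt0 divr_gt0.
have s_neq0 u : s u != 0 by rewrite lt0r_neq0.
have sE u : w u / c u = (s u)^-1 ^+ 2.
  by rewrite exprVn sqr_sqrtr ?invf_div // ltW ?divr_gt0.
pose B := \matrix_(u, v) (s u * A u v * s v).
have symB u v : B u v = B v u by rewrite !mxE symA; ring.
have [d [p [q [BE B0 orth eig _]]]] := @sym_spectral R n B symB.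
apply: (@reverse_CS_congr _ _ _ B A (fun x u => x u / s u)).
  move=> x y; apply: eq_bigr => u _; apply: eq_bigr => v _.
  by rewrite mxE; field; rewrite !s_neq0.
apply: (@spectral_reverse_CS _ _ B d p q BE B0) => i j di dj.
have par k (g : 'I_n -> R) : 0 < d k ->
    (forall u, \sum_v B u v * g v = d k * g u) ->
    exists a, forall u, g u = a * (c u / s u).
  (* The index [i] doubles as a vertex here: the ratio of [s g] to [c] is constant and is read off
     at [i]. *)
  move=> dk gE; exists (s i * g i / c i) => u.
  have := @Perron_eigenvector _ _ A c w (d k) (fun u => s u * g u)
    symA A_gt0 c_gt0 cE dk _ (yle _) u i.
  have yE v : \sum_v0 A v v0 * (s v0 * g v0) = d k * (w v / c v) * (s v * g v).
    apply: (mulfI (s_neq0 v)).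
    transitivity (\sum_v0 B v v0 * g v0).
      by rewrite mulr_sumr; apply: eq_bigr => v0 _; rewrite mxE; ring.
    by rewrite gE sE; field; rewrite s_neq0.
  move=> /(_ yE) e.
  apply: (mulfI (s_neq0 u)); apply: (mulIf (lt0r_neq0 (c_gt0 i))).
  rewrite e; field; rewrite s_neq0 lt0r_neq0 //.
have [a ap] := par i (p i) di (fun u => (eig i u).1).
have [b bq] := par i (q i) di (fun u => (eig i u).2).
have [a' ap'] := par j (p j) dj (fun u => (eig j u).1).
have [b' bq'] := par j (q j) dj (fun u => (eig j u).2).
pose N := \sum_u (c u / s u) ^+ 2.
have [ii _] := orth i i; have [jj _] := orth j j; have [ij ji] := orth i j.
have iiE : (a ^+ 2 + b ^+ 2) * N = 1.
  rewrite eqxx in ii; rewrite -[RHS]ii mulr_sumr; apply: eq_bigr => u _.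
  rewrite ap bq; ring.
have jjE : (a' ^+ 2 + b' ^+ 2) * N = 1.
  rewrite eqxx in jj; rewrite -[RHS]jj mulr_sumr; apply: eq_bigr => u _.
  rewrite ap' bq'; ring.
have ijE : (a * a' + b * b') * N = (i == j)%:R.
  rewrite -ij mulr_sumr; apply: eq_bigr => u _; rewrite ap bq ap' bq'; ring.
have jiE : (b * a' - a * b') * N = 0.
  rewrite -[RHS]ji mulr_sumr; apply: eq_bigr => u _; rewrite ap bq ap' bq'; ring.
apply/eqP; apply: contraT => nij; rewrite (negbTE nij) in ijE.
(* The identity [|z|^2 |z'|^2 = |z conj(z')|^2] for [z = a + 'i b] and [z' = a' + 'i b']: unit norms
   and orthogonality would give 1 = 0. *)
have : ((a ^+ 2 + b ^+ 2) * N) * ((a' ^+ 2 + b' ^+ 2) * N) =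
  ((a * a' + b * b') * N) ^+ 2 + ((b * a' - a * b') * N) ^+ 2 by ring.
rewrite iiE jjE ijE jiE expr0n /= addr0 mulr1 => /eqP.
by rewrite oner_eq0.
Qed.

(** * Mixed clique volumes *)

(* The mixed [G]-volume of [K_t] with vertex weights [w * x] for [x] in [s]. *)
Fixpoint mixvol {R : comPzRingType} {n : nat} (G : 'I_n -> 'I_n -> R)
    (w : 'I_n -> R) (s : seq ('I_n -> R)) : R :=
  if s is x :: s' then
    \sum_u w u * x u * mixvol G (fun v => w v * G u v) s'
  else 1.

(** The vertex weight sits in [w] rather than in the list because the recursion multiplies [w] by
    rows of [G]; [clique_volE] moves it into the list. *)
Definition clique_vol {R : comPzRingType} {n : nat} (G : 'I_n -> 'I_n -> R)
  (t : nat) (w : 'I_n -> R) : R := mixvol G w (nseq t (fun=> 1)).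

(** Each step places a nonadjacent pair [(i, 1)], [(i, 2)] at [u] and [v]. The remaining vertices of
    the first side are adjacent to [(i, 2)], hence reweighted by row [v], and those of the second
    side by row [u]. *)
Fixpoint double_cover_vol {R : comPzRingType} {n : nat}
    (G : 'I_n -> 'I_n -> R) (t : nat) (a b : 'I_n -> R) : R :=
  if t is t'.+1 then
    \sum_u \sum_v a u * b v *
      double_cover_vol G t' (fun x => a x * G v x) (fun x => b x * G u x)
  else 1.

Section Mixvol.
Context {R : comPzRingType} {n : nat}.
Implicit Types (G : 'I_n -> 'I_n -> R) (w x y : 'I_n -> R).

Lemma mixvol_cons G w x s :
  mixvol G w (x :: s) = \sum_u w u * x u * mixvol G (fun v => w v * G u v) s.
Proof. by []. Qed.

Lemma mixvol_ext G w w' s : w =1 w' -> mixvol G w s = mixvol G w' s.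
Proof.
elim: s w w' => //= x s IH w w' e; apply: eq_bigr => u _.
by rewrite e; congr (_ * _); apply: IH => v; rewrite e.
Qed.

(** Conditioning on a vertex changes the common weight; this carries the change over to the
    arguments, where the inequalities are stated. *)
Lemma mixvol_scale G w h s :
  mixvol G (fun v => w v * h v) s =
  mixvol G w [seq (fun v => x v * h v) | x : 'I_n -> R <- s].
Proof.
elim: s w => //= x s IH w; apply: eq_bigr => u _.
rewrite -IH (mulrAC (w u)) mulrA; congr (_ * _); apply: mixvol_ext => v; ring.
Qed.

Lemma clique_volS G t w :
  clique_vol G t.+1 w = \sum_u w u * clique_vol G t (fun v => w v * G u v).
Proof.
by rewrite /clique_vol [nseq _ _]/= mixvol_cons; apply: eq_bigr => u _; rewrite mulr1.
Qed.

Lemma clique_volE G t w : clique_vol G t w = mixvol G (fun=> 1) (nseq t w).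
Proof.
rewrite /clique_vol (@mixvol_ext G w (fun v => 1 * w v)); last by move=> v; ring.
rewrite mixvol_scale map_nseq; elim: t (fun=> 1) => //= t IH w'.
by apply: eq_bigr => u _; rewrite IH mul1r.
Qed.

(** The Hessian-type matrix of the Bochner method: two vertices are placed at [u] and [v], and the
    others are reweighted by both rows. *)
Definition mixvol_mx G w s : 'I_n -> 'I_n -> R := fun u v =>
  w u * w v * G u v * mixvol G (fun k => w k * G u k * G v k) s.

Lemma mixvol_bilin G w x y s :
  mixvol G w (x :: y :: s) = bilin (mixvol_mx G w s) x y.
Proof.
rewrite mixvol_cons; apply: eq_bigr => u _.
rewrite mixvol_cons !mulr_sumr; apply: eq_bigr => v _.
by rewrite /mixvol_mx; ring.
Qed.

Section Symmetric.
Context {G : 'I_n -> 'I_n -> R} (symG : forall u v, G u v = G v u).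

Lemma mixvol_mx_sym w s u v : mixvol_mx G w s u v = mixvol_mx G w s v u.
Proof.
rewrite /mixvol_mx symG (mulrC (w u)); congr (_ * _).
by apply: mixvol_ext => k; rewrite mulrAC.
Qed.

Lemma mixvol_swap w x y s : mixvol G w (x :: y :: s) = mixvol G w (y :: x :: s).
Proof.
rewrite !mixvol_bilin [RHS]exchange_big; apply: eq_bigr => u _.
by apply: eq_bigr => v _ /=; rewrite mixvol_mx_sym; ring.
Qed.

(** The recursion only conditions on the head of the list; symmetry of [mixvol] in its arguments
    lets any entry become the head. *)
Lemma mixvol_cat_cons w x s1 s2 :
  mixvol G w (s1 ++ x :: s2) = mixvol G w (x :: s1 ++ s2).
Proof.
elim: s1 w => // y s1 IH w; rewrite !cat_cons mixvol_swap !(mixvol_cons _ _ y).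
by apply: eq_bigr => u _; rewrite -IH.
Qed.

End Symmetric.
End Mixvol.

Definition positive {R : numDomainType} {n : nat} (x : 'I_n -> R) : bool :=
  [forall u, 0 < x u].

(** The vertex [i] keeps the sums from being empty. *)
Lemma mixvol_gt0 (R : numDomainType) (n : nat) (G : 'I_n -> 'I_n -> R) w s
    (i : 'I_n) :
  (forall u v, 0 < G u v) -> (forall u, 0 < w u) -> all positive s ->
  0 < mixvol G w s.
Proof.
move=> G_gt0; elim: s w => //= x s IH w w_gt0 /andP[/forallP x_gt0 /IH{}IH].
have T_gt0 u : 0 < w u * x u * mixvol G (fun v => w v * G u v) s.
  by rewrite !mulr_gt0 // IH // => v; rewrite mulr_gt0.
rewrite (bigD1 i) //= ltr_wpDr //; apply: sumr_ge0 => u _; exact: ltW.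
Qed.

(* Alexandrov-Fenchel for clique volumes. *)
Lemma mixvol_reverse_CS (R : rcfType) (n : nat) (G : 'I_n -> 'I_n -> R) w s :
  (forall u v, G u v = G v u) -> (forall u v, 0 < G u v) -> reverse_CS G ->
  (forall u, 0 < w u) -> all positive s -> reverse_CS (mixvol_mx G w s).
Proof.
move=> symG G_gt0 csG; elim: s w => [|c s IH] w w_gt0.
  move=> _; apply: (@reverse_CS_congr _ _ _ G _ (fun x u => w u * x u)) => // x y.
  by apply: eq_bigr => u _; apply: eq_bigr => v _; rewrite /mixvol_mx /=; ring.
move=> s_gt0; move: (s_gt0) => /= /andP[c_pos s'_gt0].
have c_gt0 := forallP c_pos.
pose wu u v := w v * G u v.
have wu_gt0 u v : 0 < wu u v by rewrite mulr_gt0.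
(* Row [u] of [A y] is a form of one vertex fewer, so the Bochner inequality can be compared vertex
   by vertex. *)
have rowE y u : \sum_v mixvol_mx G w (c :: s) u v * y v =
    w u * bilin (mixvol_mx G (wu u) s) y c.
  rewrite -mixvol_bilin [mixvol _ _ _]/= mulr_sumr; apply: eq_bigr => v _.
  by rewrite /mixvol_mx /wu /=; ring.
have diag_gt0 u : 0 < bilin (mixvol_mx G (wu u) s) c c.
  rewrite -mixvol_bilin; apply: mixvol_gt0 => //=.
  by rewrite !c_pos.
apply: (@reverse_CS_trickle_down _ _ _ c
   (fun u => w u * bilin (mixvol_mx G (wu u) s) c c)) => //.
- exact: mixvol_mx_sym.
- move=> u v; rewrite !mulr_gt0 //; apply: mixvol_gt0 => // k.
  by rewrite !mulr_gt0.
move=> y; rewrite -mixvol_bilin.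
(* Conditioning on the vertex that carries [c] writes [bilin A y y] as a sum over [u]; the induction
   hypothesis for the weight [wu u] bounds each term. *)
rewrite (@mixvol_cat_cons _ _ _ symG _ _ [:: y; y]) cat_cons mixvol_cons.
apply: ler_sum => u _.
rewrite rowE mixvol_bilin -/(wu u).
set b := bilin (mixvol_mx G (wu u) s) y c.
have cs := IH _ (wu_gt0 u) s'_gt0 y c (diag_gt0 u).
have -> : c u * (w u * b) ^+ 2 / (w u * bilin (mixvol_mx G (wu u) s) c c) =
   w u * c u * (b ^+ 2 / bilin (mixvol_mx G (wu u) s) c c).
  by field; rewrite !lt0r_neq0.
by rewrite ler_pM2l ?mulr_gt0 // ler_pdivlMr.
Qed.

Lemma mixvol_log_concave (R : rcfType) (n : nat) (G : 'I_n -> 'I_n -> R)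
    (w a b : 'I_n -> R) (t : nat) :
  (forall u v, G u v = G v u) -> (forall u v, 0 < G u v) -> reverse_CS G ->
  (forall u, 0 < w u) -> (forall u, 0 < a u) -> (forall u, 0 < b u) ->
  mixvol G w (nseq t.+1 a) * mixvol G w (nseq t.+1 b) <=
  mixvol G w (b :: nseq t a) * mixvol G w (a :: nseq t b).
Proof.
move=> symG G_gt0 csG w_gt0 a_gt0 b_gt0.
case: (pickP (fun _ : 'I_n => true)) => [i _|no_vertex]; last first.
  by rewrite [X in X * _]/= big1 ?mul0r => [|u]; [rewrite /= !big1 ?mulr0 // => u |];
     have := no_vertex u.
(* Along [k + j = t + 1] these numbers are log-concave, so the ratio [al k j.+1 / al k.+1 j]
   decreases in [j]; [step] compares it with its first value, and [k = 0] gives the claim. *)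
pose al k j := mixvol G w (nseq k a ++ nseq j b).
have al_gt0 k j : 0 < al k j.
  by apply: mixvol_gt0 => //; rewrite all_cat !all_nseq; apply/andP;
     split; apply/orP; right; apply/forallP.
have al_lc k j : al k.+2 j * al k j.+2 <= al k.+1 j.+1 ^+ 2.
  pose s := nseq k a ++ nseq j b.
  have s_gt0 : all positive s.
    by rewrite all_cat !all_nseq; apply/andP; split; apply/orP; right; apply/forallP.
  have -> : al k.+2 j = bilin (mixvol_mx G w s) a a by rewrite -mixvol_bilin.
  have -> : al k j.+2 = bilin (mixvol_mx G w s) b b.
    by rewrite -mixvol_bilin /al (mixvol_cat_cons symG) -cat_cons (mixvol_cat_cons symG).
  have -> : al k.+1 j.+1 = bilin (mixvol_mx G w s) a b.
    by rewrite -mixvol_bilin /al (mixvol_cat_cons symG) (mixvol_swap symG).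
  apply: mixvol_reverse_CS => //; rewrite -mixvol_bilin.
  apply: mixvol_gt0 => //=; rewrite s_gt0 andbT andbb; exact/forallP.
have step j k : (k + j = t)%N -> al t.+1 0 * al k j.+1 <= al t 1 * al k.+1 j.
  elim: j k => [|j IH] k kj; first by rewrite addn0 in kj; rewrite kj mulrC.
  have := IH k.+1; rewrite addSnnS => /(_ kj) {}IH.
  rewrite -(ler_pM2l (al_gt0 k.+2 j)).
  have := ler_wpM2r (ltW (al_gt0 k.+1 j.+1)) IH.
  have := ler_wpM2l (ltW (al_gt0 t.+1 0)) (al_lc k j).
  lra.
have := step t 0 (add0n t); rewrite /al [nseq 1 b]/= cats0 cat0s.
by rewrite (mixvol_cat_cons symG) cats0.
Qed.

Lemma clique_vol_le_double_cover (R : rcfType) (n : nat)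
    (G : 'I_n -> 'I_n -> R) (t : nat) (a b : 'I_n -> R) :
  (forall u v, G u v = G v u) -> (forall u v, 0 < G u v) -> reverse_CS G ->
  (forall u, 0 < a u) -> (forall u, 0 < b u) ->
  clique_vol G t a * clique_vol G t b <= double_cover_vol G t a b.
Proof.
move=> symG G_gt0 csG; elim: t a b => [|t IH] a b a_gt0 b_gt0 /=.
  by rewrite /clique_vol /= mulr1.
apply: (@le_trans _ _ (\sum_u \sum_v a u * b v *
    (clique_vol G t (fun x => a x * G v x) * clique_vol G t (fun x => b x * G u x)))).
  rewrite !clique_volE.
  have := @mixvol_log_concave R n G (fun=> 1) a b t symG G_gt0 csG
    (fun=> ltr01) a_gt0 b_gt0.
  move=> /le_trans; apply.
  (* The middle sum factors: [a u] goes with the [b]-clique conditioned at [u], and [b v] with the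
     [a]-clique conditioned at [v]. *)
  rewrite [X in _ <= X]exchange_big /= big_distrlr /= le_eqVlt; apply/orP; left.
  apply/eqP; apply: eq_bigr => v _; apply: eq_bigr => u _.
  rewrite !clique_volE !mul1r -[fun x => _ * G v x]/(fun x => a x * G v x).
  have e c k : mixvol G (fun x => 1 * G k x) (nseq t c) =
      mixvol G (fun=> 1) (nseq t (fun x => c x * G k x)).
    by rewrite mixvol_scale map_nseq.
  by rewrite !e; ring.
apply: ler_sum => u _; apply: ler_sum => v _.
by rewrite ler_pM2l ?mulr_gt0 // IH // => x; rewrite mulr_gt0.
Qed.

(** * Recursion over the vertices of the clique *)

Definition ffun_cons {T : finType} {t : nat} (u : T) (psi : {ffun 'I_t -> T}) :
    {ffun 'I_t.+1 -> T} :=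
  [ffun i => if unlift ord0 i is Some j then psi j else u].

Lemma ffun_cons0 (T : finType) (t : nat) (u : T) (psi : {ffun 'I_t -> T}) :
  ffun_cons u psi ord0 = u.
Proof. by rewrite ffunE unlift_none. Qed.

Lemma ffun_consS (T : finType) (t : nat) (u : T) (psi : {ffun 'I_t -> T}) i :
  ffun_cons u psi (lift ord0 i) = psi i.
Proof. by rewrite ffunE liftK. Qed.

Lemma sum_ffun_recl (R : nmodType) (T : finType) (t : nat)
    (F : {ffun 'I_t.+1 -> T} -> R) :
  \sum_phi F phi = \sum_u \sum_psi F (ffun_cons u psi).
Proof.
rewrite pair_bigA /=.
apply: (reindex (fun p : T * {ffun 'I_t -> T} => ffun_cons p.1 p.2)).
exists (fun phi : {ffun 'I_t.+1 -> T} =>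
          (phi ord0, [ffun i => phi (lift ord0 i)])) => [[u psi] _|phi _] /=.
  by rewrite ffun_cons0; congr pair; apply/ffunP => i; rewrite ffunE ffun_consS.
by apply/ffunP => i; rewrite ffunE; case: unliftP => [j|] ->; rewrite ?ffunE.
Qed.

Lemma prod_ltn_recl (R : comPzRingType) (t : nat) (F : 'I_t.+1 -> 'I_t.+1 -> R) :
  \prod_(i < t.+1) \prod_(j < t.+1 | (i < j)%N) F i j =
  (\prod_j F ord0 (lift ord0 j)) *
  \prod_(i < t) \prod_(j < t | (i < j)%N) F (lift ord0 i) (lift ord0 j).
Proof.
rewrite big_ord_recl; congr (_ * _).
  by rewrite big_mkcond big_ord_recl /= mul1r.
apply: eq_bigr => i _; rewrite big_mkcond big_ord_recl /= mul1r.
by rewrite [RHS]big_mkcond.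
Qed.

Lemma prod_neq_recl (R : comPzRingType) (t : nat) (F : 'I_t.+1 -> 'I_t.+1 -> R) :
  \prod_(i < t.+1) \prod_(j < t.+1 | i != j) F i j =
  (\prod_j F ord0 (lift ord0 j)) * (\prod_i F (lift ord0 i) ord0) *
  \prod_(i < t) \prod_(j < t | i != j) F (lift ord0 i) (lift ord0 j).
Proof.
rewrite big_ord_recl -mulrA; congr (_ * _).
  by rewrite big_mkcond big_ord_recl eqxx /= mul1r.
rewrite -big_split; apply: eq_bigr => i _.
rewrite big_mkcond big_ord_recl [RHS]/=; congr (_ * _).
by rewrite [RHS]big_mkcond; apply: eq_bigr => j _; rewrite (inj_eq lift_inj).
Qed.

Lemma VKtE (R : realType) (n t : nat) (G : 'M[R]_n) (x : 'I_n -> R) :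
  VKt t G x = clique_vol G t x.
Proof.
elim: t x => [|t IH] x.
  rewrite /VKt /clique_vol /=; under eq_bigr do rewrite !big_ord0 mulr1.
  by rewrite sumr_const card_ffun !card_ord expn0.
rewrite /VKt sum_ffun_recl clique_volS; apply: eq_bigr => u _.
rewrite -IH mulr_sumr; apply: eq_bigr => psi _.
rewrite prod_ltn_recl big_ord_recl !ffun_cons0 big_split /=.
have -> : \prod_(i < t) \prod_(j < t | (i < j)%N)
    G (ffun_cons u psi (lift ord0 i)) (ffun_cons u psi (lift ord0 j)) =
    \prod_(i < t) \prod_(j < t | (i < j)%N) G (psi i) (psi j).
  by apply: eq_bigr => i _; apply: eq_bigr => j _; rewrite !ffun_consS.
have -> : \prod_(j < t) G u (ffun_cons u psi (lift ord0 j)) =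
    \prod_(j < t) G u (psi j) by apply: eq_bigr => j _; rewrite ffun_consS.
have -> : \prod_(j < t) x (ffun_cons u psi (lift ord0 j)) =
    \prod_(j < t) x (psi j) by apply: eq_bigr => j _; rewrite ffun_consS.
ring.
Qed.

Lemma VKtK2E (R : realType) (n t : nat) (G : 'M[R]_n) (a b : 'I_n -> R) :
  (forall u v, G u v = G v u) -> VKtK2 t G a b = double_cover_vol G t a b.
Proof.
move=> symG.
(* Splitting [phi] into its restrictions to the two sides lets the first vertex of each side be
   peeled off separately. *)
pose V t a b := \sum_(phi : {ffun 'I_t -> 'I_n}) \sum_(psi : {ffun 'I_t -> 'I_n})
   (\prod_(i < t) \prod_(j < t | i != j) G (phi i) (psi j)) *
   \prod_(i < t) (a (phi i) * b (psi i)) : R.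
transitivity (V t a b).
  rewrite /V pair_bigA /=.
  pose h (p : {ffun 'I_t -> 'I_n} * {ffun 'I_t -> 'I_n}) : {ffun 'I_t * 'I_2 -> 'I_n} :=
    [ffun q => if q.2 == ord0 then p.1 q.1 else p.2 q.1].
  rewrite /VKtK2 (reindex h) /=; last first.
    exists (fun phi => ([ffun i => phi (i, ord0)], [ffun i => phi (i, ord_max)])).
      by move=> [phi psi] _; congr pair; apply/ffunP => i; rewrite !ffunE.
    move=> phi _; apply/ffunP => -[i k]; rewrite !ffunE /=.
    by case: eqP => [->|k0] //; congr (phi (i, _)); apply/val_inj;
       case: k k0 => [[|[|]]] //= lt k0; case: k0; apply: val_inj.
  apply: eq_bigr => -[phi psi] _; congr (_ * _).
    by apply: eq_bigr => i _; apply: eq_bigr => j _; rewrite !ffunE.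
  by apply: eq_bigr => i _; rewrite !ffunE.
elim: t a b => [|t IH] a b.
  rewrite /V; under eq_bigr do under eq_bigr do rewrite !big_ord0 mulr1.
  by rewrite !sumr_const card_ffun !card_ord expn0.
rewrite /V sum_ffun_recl /=; apply: eq_bigr => u _.
under eq_bigr do rewrite sum_ffun_recl.
rewrite exchange_big /=; apply: eq_bigr => v _.
rewrite -IH mulr_sumr; apply: eq_bigr => phi _.
rewrite mulr_sumr; apply: eq_bigr => psi _.
rewrite prod_neq_recl big_ord_recl !ffun_cons0 !big_split /=.
have -> : \prod_(i < t) \prod_(j < t | i != j)
    G (ffun_cons u phi (lift ord0 i)) (ffun_cons v psi (lift ord0 j)) =
    \prod_(i < t) \prod_(j < t | i != j) G (phi i) (psi j).
  by apply: eq_bigr => i _; apply: eq_bigr => j _; rewrite !ffun_consS.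
have -> : \prod_(j < t) G u (ffun_cons v psi (lift ord0 j)) =
    \prod_(j < t) G u (psi j) by apply: eq_bigr => j _; rewrite ffun_consS.
have -> : \prod_(i < t) G (ffun_cons u phi (lift ord0 i)) v =
    \prod_(i < t) G v (phi i).
  by apply: eq_bigr => j _; rewrite ffun_consS symG.
have -> : \prod_(j < t) a (ffun_cons u phi (lift ord0 j)) =
    \prod_(j < t) a (phi j) by apply: eq_bigr => j _; rewrite ffun_consS.
have -> : \prod_(j < t) b (ffun_cons v psi (lift ord0 j)) =
    \prod_(j < t) b (psi j) by apply: eq_bigr => j _; rewrite ffun_consS.
ring.
Qed.

(** * Perturbation to positive weights *)

Lemma clique_vol_ext (R : comPzRingType) (n : nat) (G G' : 'I_n -> 'I_n -> R)
    (t : nat) (w w' : 'I_n -> R) :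
  G =2 G' -> w =1 w' -> clique_vol G t w = clique_vol G' t w'.
Proof.
move=> eG; elim: t w w' => [//|t IH] w w' ew; rewrite !clique_volS.
apply: eq_bigr => u _; rewrite ew; congr (_ * _).
by apply: IH => v; rewrite ew eG.
Qed.

Lemma double_cover_vol_ext (R : comPzRingType) (n : nat)
    (G G' : 'I_n -> 'I_n -> R) (t : nat) (a a' b b' : 'I_n -> R) :
  G =2 G' -> a =1 a' -> b =1 b' ->
  double_cover_vol G t a b = double_cover_vol G' t a' b'.
Proof.
move=> eG; elim: t a a' b b' => [//|t IH] a a' b b' ea eb /=.
apply: eq_bigr => u _; apply: eq_bigr => v _; rewrite ea eb; congr (_ * _).
by apply: IH => k; rewrite ?ea ?eb eG.
Qed.

Section Morphism.
Context {R S : comPzRingType} (f : {rmorphism R -> S}) {n : nat}.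
Implicit Types (G : 'I_n -> 'I_n -> R) (w a b : 'I_n -> R).

(** Intended for evaluation of polynomials: volumes formed over [{poly R}] specialize to the
    perturbed volumes at every [e]. *)
Lemma rmorph_clique_vol G t w :
  f (clique_vol G t w) = clique_vol (fun u v => f (G u v)) t (f \o w).
Proof.
elim: t w => [|t IH] w; first exact: rmorph1.
rewrite !clique_volS rmorph_sum; apply: eq_bigr => u _; rewrite rmorphM IH.
by congr (_ * _); apply: clique_vol_ext => // v /=; rewrite rmorphM.
Qed.

Lemma rmorph_double_cover_vol G t a b :
  f (double_cover_vol G t a b) =
  double_cover_vol (fun u v => f (G u v)) t (f \o a) (f \o b).
Proof.
elim: t a b => [|t IH] a b /=; first exact: rmorph1.
rewrite rmorph_sum; apply: eq_bigr => u _; rewrite rmorph_sum.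
apply: eq_bigr => v _; rewrite !rmorphM IH; congr (_ * _).
by apply: double_cover_vol_ext => // k /=; rewrite rmorphM.
Qed.

Lemma rmorph_bilin G w a :
  f (bilin G w a) = bilin (fun u v => f (G u v)) (f \o w) (f \o a).
Proof.
rewrite rmorph_sum; apply: eq_bigr => u _; rewrite rmorph_sum.
by apply: eq_bigr => v _; rewrite !rmorphM.
Qed.

End Morphism.

(** The form of [S A S^T] is that of [A] after a linear substitution; with [S = I + e J] this
    transfers [reverse_CS] to the perturbed graph. *)
Lemma bilin_compose (R : comPzRingType) (n : nat) (A S : 'I_n -> 'I_n -> R) x y :
  bilin (fun u v => bilin A (S u) (S v)) x y =
  bilin A (fun k => \sum_u x u * S u k) (fun l => \sum_v y v * S v l).
Proof.
rewrite /bilin !pair_bigA /=.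
transitivity (\sum_(p : 'I_n * 'I_n) \sum_(q : 'I_n * 'I_n)
    x p.1 * (S p.1 q.1 * A q.1 q.2 * S p.2 q.2) * y p.2).
  by apply: eq_bigr => p _; rewrite pair_bigA mulr_sumr mulr_suml.
rewrite exchange_big /=; apply: eq_bigr => q _.
rewrite mulrAC big_distrlr pair_bigA mulr_suml /=.
by apply: eq_bigr => p _; ring.
Qed.

Lemma poly_ge0_at0 (R : realFieldType) (p : {poly R}) :
  (forall e, 0 < e -> 0 <= p.[e]) -> 0 <= p.[0].
Proof.
elim/poly_ind: p => [|q c _] p_ge0; first by rewrite horner0.
have {}p_ge0 e : 0 < e -> 0 <= q.[e] * e + c.
  by move=> /p_ge0; rewrite hornerD hornerM hornerX hornerC.
rewrite hornerD hornerM hornerX hornerC mulr0 add0r leNgt; apply/negP => c_lt0.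
have [B qB] := poly_itv_bound q 0 1.
have B_ge0 : 0 <= B by apply: le_trans (qB 0 _) => //; rewrite lexx ler01.
have D_gt0 : 0 < B + 1 - c by lra.
(* Chosen in [(0, 1]] so that [B e + c = - e (1 - c) < 0], where [B] bounds [q] on [[0, 1]]. *)
pose e := - c / (B + 1 - c).
have e_gt0 : 0 < e by rewrite divr_gt0 // oppr_gt0.
have e_le1 : e <= 1 by rewrite ler_pdivrMr //; lra.
have eE : e * (B + 1 - c) = - c by rewrite /e mulfVK // lt0r_neq0.
have := p_ge0 e e_gt0.
have := qB e; rewrite (ltW e_gt0) e_le1 => /(_ isT) qe.
have := ler_norm q.[e].
nra.
Qed.

Theorem theorem4p3 (R : realType) (n t : nat) (G : 'M[R]_n)
  (a b : 'I_n -> R) :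
  antiferromagnetic G -> (2 <= t)%N ->
  (forall v, 0 <= a v) -> (forall v, 0 <= b v) ->
  VKt t G a * VKt t G b <= VKtK2 t G a b.
Proof.
move=> afG t_ge2 a_ge0 b_ge0.
have [[symG G_ge0] _] := afG.
have csG := @antiferromagnetic_reverse_CS R n G afG.
rewrite !VKtE VKtK2E //.
(* One positive entry of [G] makes every entry of [(I + e J) G (I + e J)] positive for [e > 0], so
   [G = 0] has to be treated apart. *)
case: (pickP (fun p : 'I_n * 'I_n => 0 < G p.1 p.2)) => [[i j] /= Gij|G_le0].
  pose Sp (u k : 'I_n) : {poly R} := (u == k)%:R + 'X.
  pose Gp u v := bilin (fun k l => (G k l)%:P) (Sp u) (Sp v).
  pose ap u := (a u)%:P + 'X.
  pose bp u := (b u)%:P + 'X.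
  pose S e (u k : 'I_n) : R := (u == k)%:R + e.
  pose Ge e u v := bilin G (S e u) (S e v).
  pose gap := double_cover_vol Gp t ap bp - clique_vol Gp t ap * clique_vol Gp t bp.
  have gapE e : gap.[e] = double_cover_vol (Ge e) t (fun u => a u + e) (fun u => b u + e) -
     clique_vol (Ge e) t (fun u => a u + e) * clique_vol (Ge e) t (fun u => b u + e).
    have GpE u v : (Gp u v).[e] = Ge e u v.
      rewrite -[LHS]/(horner_eval e _) rmorph_bilin.
      apply: eq_bigr => k _; apply: eq_bigr => l _ /=.
      by rewrite /horner_eval /Sp !hornerD !hornerX hornerC -!polyC_natr !hornerC.
    have apE u : (ap u).[e] = a u + e by rewrite hornerD hornerC hornerX.
    have bpE u : (bp u).[e] = b u + e by rewrite hornerD hornerC hornerX.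
    rewrite -[LHS]/(horner_eval e _) rmorphB rmorphM !rmorph_clique_vol.
    rewrite rmorph_double_cover_vol; congr (_ - _ * _).
    - exact: double_cover_vol_ext.
    - exact: clique_vol_ext.
    - exact: clique_vol_ext.
  have S0 u v : Ge 0 u v = G u v.
    rewrite /Ge /bilin (bigD1 u) //= (bigD1 v) //= !big1 => [|k ku|l lv].
    - by rewrite /S !eqxx /=; ring.
    - by rewrite big1 // => l _; rewrite /S eq_sym (negbTE ku) /=; ring.
    - by rewrite /S (eq_sym v) (negbTE lv) /=; ring.
  have := @poly_ge0_at0 R gap; rewrite gapE subr_ge0.
  rewrite (@double_cover_vol_ext _ _ _ _ t _ _ _ _ S0 (fun u => addr0 (a u)) (fun u => addr0 (b u))).
  rewrite (@clique_vol_ext _ _ _ _ t _ _ S0 (fun u => addr0 (a u))).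
  rewrite (@clique_vol_ext _ _ _ _ t _ _ S0 (fun u => addr0 (b u))); apply => e e_gt0.
  have S_gt0 u k : 0 < S e u k by rewrite /S ltr_wpDl // ler0n.
  rewrite gapE subr_ge0; apply: clique_vol_le_double_cover.
  - move=> u v; rewrite /Ge /bilin exchange_big; apply: eq_bigr => k _.
    by apply: eq_bigr => l _; rewrite /= symG; ring.
  - move=> u v; have T_ge0 k l : 0 <= S e u k * G k l * S e v l.
      by rewrite !mulr_ge0 // ltW.
    rewrite /Ge /bilin (bigD1 i) //= (bigD1 j) //= -addrA ltr_wpDr //.
      by rewrite addr_ge0 ?sumr_ge0 // => k _; rewrite sumr_ge0.
    by rewrite !mulr_gt0.
  - apply: (@reverse_CS_congr _ _ _ G _ (fun x k => \sum_u x u * S e u k)) => // x y.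
    exact: bilin_compose.
  - by move=> u; rewrite ltr_wpDl.
  - by move=> u; rewrite ltr_wpDl.
have G0 u v : G u v = 0.
  by apply/eqP; rewrite eq_le G_ge0 andbT leNgt (G_le0 (u, v)).
(* With [G = 0] the clique volume vanishes, since two vertices already span an edge; the other side
   is a sum of nonnegative terms. *)
case: t t_ge2 => [|[|t]] // _.
have -> : clique_vol G t.+2 a = 0.
  rewrite clique_volS big1 // => u _; rewrite clique_volS big1 ?mulr0 // => v _.
  by rewrite G0 mulr0 mul0r.
rewrite mul0r.
have dc_ge0 s (x y : 'I_n -> R) : (forall u, 0 <= x u) -> (forall u, 0 <= y u) ->
    0 <= double_cover_vol G s x y.
  elim: s x y => //= s IH x y x_ge0 y_ge0.
  apply: sumr_ge0 => u _; apply: sumr_ge0 => v _.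
  by rewrite !mulr_ge0 // IH // => k; rewrite mulr_ge0.
exact: dc_ge0.
Qed.
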